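(* Let $(A,\succ,\cdot)$ be a commutative tridendriform algebra, $(A_h,\succ_h,\prec_h,\cdot_h)$ a tridendriform deformation of it and $(A,[,],\triangleright,\succ,\cdot)$ the quasiclassical limit post-Poisson algebra. Define on $A$: $x\circ y:=x\succ y+y\succ x+x\cdot y$ and $\{x,y\}:=x\triangleright y-y\triangleright x+[x,y]$, and on $A_h$: $x\circ_hy:=x\succ_hy+x\prec_hy+x\cdot_hy$. Then: (1) The topologically free $(A_h,\circ_h)$-bimodule algebra $(A_h,\cdot_h,L_{\succ_h},R_{\prec_h})$ is an $A_h$-bimodule algebra deformation of the $(A,\circ)$-module algebra $(A,\cdot,L_\succ)$, and its quasiclassical limit is the $(A,\{,\},\circ)$-module Poisson algebra $(A,[,],\cdot,L_\triangleright,L_\succ)$. (2) The $\mathcal O$-operator $\mathrm{id}_{A_h}$ of weight $1$ on $(A_h,\circ_h)$ associated to $(A_h,\cdot_h,L_{\succ_h},R_{\prec_h})$ induced by the tridendriform deformation coincides with the scalar deformation $(\mathrm{id}_A)_{\mathbf K}$ of the $\mathcal O$-operator $\mathrm{id}_A$ of weight $1$ on $(A,\circ)$ associated to $(A,\cdot,L_\succ)$ induced by $(A,\succ,\cdot)$; that is, $\mathrm{id}_{A_h}=(\mathrm{id}_A)_{\mathbf K}$. (3) The $\mathcal O$-operator $\mathrm{id}_A$ of weight $1$ on the Poisson algebra $(A,\{,\},\circ)$ associated to $(A,[,],\cdot,L_\triangleright,L_\succ)$ induced by the post-Poisson algebra $(A,[,],\triangleright,\succ,\cdot)$ coincides with the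 $\mathcal O$-operator obtained from $\mathrm{id}_{A_h}=(\mathrm{id}_A)_{\mathbf K}$ by passing to quasiclassical limits (i.e. $\mathrm{id}_A$ regarded as an $\mathcal O$-operator of weight $1$ on the quasiclassical limit of $(A_h,\circ_h)$ associated to the quasiclassical limit of $(A_h,\cdot_h,L_{\succ_h},R_{\prec_h})$). In particular, the same assertions hold when $\cdot$, $\cdot_h$ and $[,]$ are zero, that is, for a Zinbiel algebra $(A,\succ)$, a dendriform deformation $(A_h,\succ_h,\prec_h)$ of it and the quasiclassical limit pre-Poisson algebra $(A,\triangleright,\succ)$, with the modules $(A,L_\succ)$, $(A_h,L_{\succ_h},R_{\prec_h})$, $(A,L_\triangleright,L_\succ)$.
   Context: Throughout, $\mathbf{k}$ is a field of characteristic $0$, $\mathbf{K}=\mathbf{k}[[h]]$, $V_h=V[[h]]$. For an operation $*$: $L_*(x)y=x*y$, $R_*(x)y=y*x$. An associative deformation of $(A,\circ)$ is a $\mathbf K$-bilinear associative product $\circ_h$ on $A_h$ with $x\circ_hy\equiv x\circ y\pmod h$, $x,y\in A$; for $(A,\circ)$ commutative its quasiclassical limit (QCL) is the Poisson algebra $(A,\{,\},\circ)$, $\{x,y\}\equiv\frac{x\circ_hy-y\circ_hx}{h}\pmod h$. Bimodule algebras: $(V,\cdot,l,r)$ is an $A$-bimodule algebra over associative $(A,\circ)$ if $(V,\cdot)$ is associative and $A\oplus V$ with $(x,u)\odot(y,v)=(x\circ y,l(x)v+r(y)u+u\cdot v)$ is associative ($A\ltimes_{l,r}V$); in the commutative case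 with $l=r=\rho_\circ$ it is an $A$-module algebra $(V,\cdot,\rho_\circ)$; a bimodule/module is the case $\cdot=0$. Same over $\mathbf K$ for topologically free objects. $(V_h,\cdot_h,l_h,r_h)$ is an $A_h$-bimodule algebra deformation of $(V,\cdot,l,r)$ if $A_h\ltimes_{l_h,r_h}V_h$ is an associative deformation of $A\ltimes_{l,r}V$; the QCL of a deformation of a module algebra $(V,\cdot,\rho_\circ)$ is $(V,[,],\cdot,\rho_{\{,\}},\rho_\circ)$, with $(V,[,],\cdot)$ the QCL of $(V_h,\cdot_h)$ and $\rho_{\{,\}}(x)u\equiv\frac{l_h(x)u-r_h(x)u}{h}\pmod h$. $(Q,[,],\cdot,\rho_{\{,\}},\rho_\circ)$ is a $P$-module Poisson algebra over a Poisson algebra $(P,\{,\},\circ)$ if $P\oplus Q$ with bracket $(\{x,y\},\rho_{\{,\}}(x)v-\rho_{\{,\}}(y)u+[u,v])$ and product $(x\circ y,\rho_\circ(x)v+\rho_\circ(y)u+u\cdot v)$ is a Poisson algebra. $\mathcal O$-operators of weight $\lambda$: $T(u)\circ T(v)=T(l(T(u))v)+T(r(T(v))u)+\lambda T(u\cdot v)$ (associative case, also over $\mathbf K$); Poisson case: $\{T(u),T(v)\}=T(\rho_{\{,\}}(T(u))v)-T(\rho_{\{,\}}(T(v))u)+\lambda T([u,v])$ and $T(u)\circ T(v)=T(\rho_\circ(T(u))v)+T(\rho_\circ(T(v))u)+\lambda T(u\cdot v)$. Scalar deformation of $T:V\to A$: $T_{\mathbf K}(\sum v_ih^i)=\sum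 T(v_i)h^i$. (If $T$ and $T_{\mathbf K}$ are $\mathcal O$-operators of weight $\lambda$ for a module algebra and a bimodule algebra deformation of it, then $T$ is an $\mathcal O$-operator of weight $\lambda$ for the QCLs.) A tridendriform algebra $(A,\succ,\prec,\cdot)$ satisfies, with $x\circ y=x\prec y+x\succ y+x\cdot y$: $(x\prec y)\prec z=x\prec(y\circ z)$, $(x\succ y)\prec z=x\succ(y\prec z)$, $(x\circ y)\succ z=x\succ(y\succ z)$, $(x\succ y)\cdot z=x\succ(y\cdot z)$, $(x\prec y)\cdot z=x\cdot(y\succ z)$, $(x\cdot y)\prec z=x\cdot(y\prec z)$, $(x\cdot y)\cdot z=x\cdot(y\cdot z)$. It is commutative, written $(A,\succ,\cdot)$, if $x\succ y=y\prec x$ and $x\cdot y=y\cdot x$. Dendriform = tridendriform with $\cdot=0$; Zinbiel = commutative dendriform. A tridendriform (dendriform) deformation of $(A,\succ,\prec,\cdot)$ is a tridendriform algebra $(A_h,\succ_h,\prec_h,\cdot_h)$ with $\mathbf K$-bilinear operations on $A_h=A[[h]]$ reducing mod $h$ to $\succ,\prec,\cdot$ on $A$. Its QCL for commutative $(A,\succ,\cdot)$ is $(A,[,],\triangleright,\succ,\cdot)$ with $[x,y]\equiv\frac{x\cdot_hy-y\cdot_hx}{h}$, $x\triangleright y\equiv\frac{x\succ_hy-y\prec_hx}{h}\pmod h$. A post-Poisson algebra $(P,[,],\triangleright,\succ,\cdot)$: with $\circ,\{,\}$ as in the claim, $(P,[,])$ is a Lie algebra, $(P,\succ,\cdot)$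 is a commutative tridendriform algebra, $x\triangleright[y,z]=[x\triangleright y,z]+[y,x\triangleright z]$, $\{x,y\}\triangleright z=x\triangleright(y\triangleright z)-y\triangleright(x\triangleright z)$, $[x,y\cdot z]=[x,y]\cdot z+y\cdot[x,z]$, $[x,y\succ z]=y\succ[x,z]-z\cdot(y\triangleright x)$, $x\triangleright(y\cdot z)=(x\triangleright y)\cdot z+y\cdot(x\triangleright z)$, $(x\circ y)\triangleright z=x\succ(y\triangleright z)+y\succ(x\triangleright z)$, $x\triangleright(y\succ z)=y\succ(x\triangleright z)+\{x,y\}\succ z$. A pre-Poisson algebra $(A,\triangleright,\succ)$ is the case $\cdot=0$, $[,]=0$. Known background: the QCL of a tridendriform (dendriform) deformation of a commutative tridendriform (Zinbiel) algebra is a post-Poisson (pre-Poisson) algebra; $(A,\succ,\prec,\cdot)$ is tridendriform iff $(A,\circ)$ is associative and $(A,\cdot,L_\succ,R_\prec)$ is an $(A,\circ)$-bimodule algebra, and then $\mathrm{id}_A$ is an $\mathcal O$-operator of weight $1$ (same over $\mathbf K$); $(P,[,],\triangleright,\succ,\cdot)$ is post-Poisson iff $(P,\{,\},\circ)$ is Poisson and $(P,[,],\cdot,L_\triangleright,L_\succ)$ is a $(P,\{,\},\circ)$-module Poisson algebra, and then $\mathrm{id}_P$ is an $\mathcal O$-operator of weight $1$. These are the structures ''induced'' in the claim. *)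

(* Defs.v *)
From HB Require Import structures.
From mathcomp Require Import all_boot all_algebra.
From mathcomp Require Import boolp.

Set Implicit Arguments.
Unset Strict Implicit.
Unset Printing Implicit Defensive.

Import GRing.Theory.
Local Open Scope ring_scope.

(* [fps V] is V[[h]], a series being its sequence of coefficients.  For a     *)
(* commutative ring k it is a commutative ring under the Cauchy product, and  *)
(* for a k-module V it is an (fps k)-module.                                  *)
Definition fps (V : Type) : Type := nat -> V.

HB.instance Definition _ (V : Type) := gen_eqMixin (fps V).
HB.instance Definition _ (V : Type) := gen_choiceMixin (fps V).

Section FpsZmodule.
Variable V : zmodType.

Definition fps_zero : fps V := fun=> 0.
Definition fps_add (u v : fps V) : fps V := fun n => u n + v n.
Definition fps_opp (u : fps V) : fps V := fun n => - u n.

Fact fps_addA : associative fps_add.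
Proof. by move=> u v w; apply/funext => n; apply: addrA. Qed.
Fact fps_addC : commutative fps_add.
Proof. by move=> u v; apply/funext => n; apply: addrC. Qed.
Fact fps_add0 : left_id fps_zero fps_add.
Proof. by move=> u; apply/funext => n; apply: add0r. Qed.
Fact fps_addN : left_inverse fps_zero fps_opp fps_add.
Proof. by move=> u; apply/funext => n; apply: addNr. Qed.

HB.instance Definition _ :=
  GRing.isZmodule.Build (fps V) fps_addA fps_addC fps_add0 fps_addN.

End FpsZmodule.

Lemma fps_triangular_sum (V : nmodType) (F : nat -> nat -> V) (n : nat) :
  \sum_(i < n.+1) \sum_(j < i.+1) F j (i - j)%N =
  \sum_(j < n.+1) \sum_(i < (n - j).+1) F j i.
Proof.
elim: n => [|n IHn]; first by rewrite !big_ord1.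
rewrite big_ord_recr /= IHn [RHS]big_ord_recr /= subnn big_ord1.
rewrite [X in _ + X]big_ord_recr /= subnn addrA; congr (_ + _).
rewrite -big_split /=; apply: eq_bigr => j _.
have le_jn : (j <= n)%N by rewrite -ltnS.
by rewrite subSn // [RHS]big_ord_recr.
Qed.

Section FpsRing.
Variable k : comNzRingType.

Definition fps_one : fps k := fun n => (n == 0%N)%:R.
Definition fps_mul (a b : fps k) : fps k :=
  fun n => \sum_(i < n.+1) a i * b (n - i)%N.

Fact fps_mulA : associative fps_mul.
Proof.
move=> a b c; apply/funext => n; rewrite /fps_mul.
under eq_bigr do rewrite mulr_sumr.
under [RHS]eq_bigr do rewrite mulr_suml.
rewrite -(fps_triangular_sum (fun i j => a i * (b j * c (n - i - j)%N))).
apply: eq_bigr => i _; apply: eq_bigr => j _.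
by rewrite mulrA -subnDA subnKC // -ltnS.
Qed.

Fact fps_mulC : commutative fps_mul.
Proof.
move=> a b; apply/funext => n; rewrite /fps_mul (reindex_inj rev_ord_inj) /=.
by apply: eq_bigr => i _; rewrite subSS subKn 1?mulrC // -ltnS.
Qed.

Fact fps_mul1 : left_id fps_one fps_mul.
Proof.
move=> a; apply/funext => n; rewrite /fps_mul big_ord_recl big1 => [|i _].
  by rewrite /fps_one /= mul1r subn0 addr0.
by rewrite /fps_one /= mul0r.
Qed.

Fact fps_mulDl : left_distributive fps_mul +%R.
Proof.
move=> a b c; apply/funext => n; rewrite [RHS]/GRing.add /= /fps_add /fps_mul.
by rewrite -big_split; apply: eq_bigr => i _; apply: mulrDl.
Qed.

Fact fps_oner_neq0 : fps_one != 0.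
Proof.
by apply/eqP => /(congr1 (fun a : fps k => a 0%N)) /eqP; rewrite (negPf (oner_neq0 k)).
Qed.

HB.instance Definition _ := GRing.Zmodule_isComNzRing.Build (fps k)
  fps_mulA fps_mulC fps_mul1 fps_mulDl fps_oner_neq0.

End FpsRing.

Section FpsLmodule.
Variables (k : comNzRingType) (V : lmodType k).

Definition fps_scale (a : fps k) (u : fps V) : fps V :=
  fun n => \sum_(i < n.+1) a i *: u (n - i)%N.

Fact fps_scaleA a b u :
  fps_scale a (fps_scale b u) = fps_scale (a * b) u.
Proof.
apply/funext => n; rewrite /fps_scale.
under eq_bigr do rewrite scaler_sumr.
under [RHS]eq_bigr do rewrite scaler_suml.
rewrite -(fps_triangular_sum (fun i j => a i *: (b j *: u (n - i - j)%N))).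
apply: eq_bigr => i _; apply: eq_bigr => j _.
by rewrite scalerA -subnDA subnKC // -ltnS.
Qed.

Fact fps_scale1 : left_id 1 fps_scale.
Proof.
move=> u; apply/funext => n; rewrite /fps_scale big_ord_recl big1 => [|i _].
  by rewrite [X in X *: _]/(1 : k) scale1r subn0 addr0.
by rewrite [X in X *: _]/(0 : k) scale0r.
Qed.

Fact fps_scaleDr : right_distributive fps_scale +%R.
Proof.
move=> a u v; apply/funext => n; rewrite [RHS]/GRing.add /= /fps_add /fps_scale.
by rewrite -big_split; apply: eq_bigr => i _; apply: scalerDr.
Qed.

Fact fps_scaleDl u : {morph fps_scale^~ u : a b / a + b}.
Proof.
move=> a b; apply/funext => n; rewrite [RHS]/GRing.add /= /fps_add /fps_scale.
by rewrite -big_split; apply: eq_bigr => i _; apply: scalerDl.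
Qed.

HB.instance Definition _ := GRing.Zmodule_isLmodule.Build (fps k) (fps V)
  fps_scaleA fps_scale1 fps_scaleDr fps_scaleDl.

End FpsLmodule.

(* The formal parameter h in k[[h]] and the inclusion of V in V[[h]].         *)
Definition fps_h {k : comNzRingType} : fps k := fun n => (n == 1%N)%:R.

Definition fps_const {V : zmodType} (v : V) : fps V :=
  fun n => if n is 0%N then v else 0.

(* u = x (mod h), and u / h = x (mod h), for u in V[[h]] and x in V; the      *)
(* latter includes the divisibility of u by h.                                *)
Definition eq_modh {k : comNzRingType} {V : lmodType k} (u : fps V) (x : V) :=
  exists w : fps V, u - fps_const x = (fps_h : fps k) *: w.

Definition divh_eq_modh {k : comNzRingType} {V : lmodType k}
    (u : fps V) (x : V) :=
  exists2 w : fps V, u = (fps_h : fps k) *: w & eq_modh w x.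

Notation is_bilinear f := (bilinear_for *:%R *:%R f).

(* L_*(x) y = x * y and R_*(x) y = y * x.                                     *)
Definition Lmul {A : Type} (m : A -> A -> A) : A -> A -> A := fun x y => m x y.
Definition Rmul {A : Type} (m : A -> A -> A) : A -> A -> A := fun x y => m y x.

Definition null_op {A : Type} {V : zmodType} : A -> A -> V := fun _ _ => 0.

(* The notions below are stated over an arbitrary commutative ring, so that   *)
(* they apply both to k and to k[[h]].                                        *)
Section Algebras.
Variable R : comNzRingType.

Definition assoc_algebra (A : lmodType R) (m : A -> A -> A) :=
  is_bilinear m /\ associative m.

Definition lie_algebra (A : lmodType R) (br : A -> A -> A) :=
  [/\ is_bilinear br,
      (forall x, br x x = 0) &
      (forall x y z, br x (br y z) + br y (br z x) + br z (br x y) = 0)].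

Definition poisson_algebra (A : lmodType R) (br m : A -> A -> A) :=
  [/\ lie_algebra br, assoc_algebra m, commutative m &
      (forall x y z, br x (m y z) = m (br x y) z + m y (br x z))].

Section Modules.
Variables A V : lmodType R.

Definition semidirect_mul (m : A -> A -> A) (d : V -> V -> V)
    (l r : A -> V -> V) (p q : A * V) : A * V :=
  (m p.1 q.1, l p.1 q.2 + r q.1 p.2 + d p.2 q.2).

Definition semidirect_br (br : A -> A -> A) (lie : V -> V -> V)
    (rho : A -> V -> V) (p q : A * V) : A * V :=
  (br p.1 q.1, rho p.1 q.2 - rho q.1 p.2 + lie p.2 q.2).

Definition bimodule_algebra (m : A -> A -> A) (d : V -> V -> V)
    (l r : A -> V -> V) :=
  [/\ assoc_algebra m, assoc_algebra d, is_bilinear l, is_bilinear r &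
      assoc_algebra (semidirect_mul m d l r)].

Definition module_algebra (m : A -> A -> A) (d : V -> V -> V)
    (rho : A -> V -> V) :=
  [/\ commutative m, commutative d & bimodule_algebra m d rho rho].

Definition bimodule (m : A -> A -> A) (l r : A -> V -> V) :=
  bimodule_algebra m null_op l r.

Definition assoc_module (m : A -> A -> A) (rho : A -> V -> V) :=
  module_algebra m null_op rho.

Definition module_poisson_algebra (br m : A -> A -> A) (lie d : V -> V -> V)
    (rho_br rho_m : A -> V -> V) :=
  [/\ poisson_algebra br m, is_bilinear rho_br, is_bilinear rho_m &
      poisson_algebra (semidirect_br br lie rho_br)
                      (semidirect_mul m d rho_m rho_m)].

Definition poisson_module (br m : A -> A -> A) (rho_br rho_m : A -> V -> V) :=
  module_poisson_algebra br m null_op null_op rho_br rho_m.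

(* An O-operator together with the bimodule algebra it is associated to.      *)
Record assoc_O_datum := AssocODatum {
  aod_map : V -> A;
  aod_mul : A -> A -> A;
  aod_vmul : V -> V -> V;
  aod_l : A -> V -> V;
  aod_r : A -> V -> V }.

Definition assoc_O_operator (lambda : R) (D : assoc_O_datum) :=
  let: AssocODatum T m d l r := D in
  [/\ bimodule_algebra m d l r, linear T &
      forall u v : V, m (T u) (T v) =
        T (l (T u) v) + T (r (T v) u) + lambda *: T (d u v)].

(* An O-operator together with the module Poisson algebra it is associated to. *)
Record poisson_O_datum := PoissonODatum {
  pod_map : V -> A;
  pod_br : A -> A -> A;
  pod_mul : A -> A -> A;
  pod_vbr : V -> V -> V;
  pod_vmul : V -> V -> V;
  pod_rho_br : A -> V -> V;
  pod_rho_mul : A -> V -> V }.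

Definition poisson_O_operator (lambda : R) (P : poisson_O_datum) :=
  let: PoissonODatum T br m lie d rho_br rho_m := P in
  [/\ module_poisson_algebra br m lie d rho_br rho_m, linear T,
      (forall u v : V, br (T u) (T v) =
        T (rho_br (T u) v) - T (rho_br (T v) u) + lambda *: T (lie u v)) &
      (forall u v : V, m (T u) (T v) =
        T (rho_m (T u) v) + T (rho_m (T v) u) + lambda *: T (d u v))].

End Modules.

Section Tridendriform.
Variable A : lmodType R.
Implicit Types succ prec dot lie tri : A -> A -> A.

Definition tridendriform_mul succ prec dot (x y : A) : A :=
  succ x y + prec x y + dot x y.

Definition tridendriform succ prec dot :=
  let circ := tridendriform_mul succ prec dot in
  [/\ is_bilinear succ, is_bilinear prec & is_bilinear dot] /\
  [/\ (forall x y z, prec (prec x y) z = prec x (circ y z)),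
      (forall x y z, prec (succ x y) z = succ x (prec y z)) &
      (forall x y z, succ (circ x y) z = succ x (succ y z))] /\
  [/\ (forall x y z, dot (succ x y) z = succ x (dot y z)),
      (forall x y z, dot (prec x y) z = dot x (succ y z)),
      (forall x y z, prec (dot x y) z = dot x (prec y z)) &
      (forall x y z, dot (dot x y) z = dot x (dot y z))].

(* Here x < y is y > x, so only > and . are given.                            *)
Definition comm_tridendriform succ dot :=
  tridendriform succ (Rmul succ) dot /\ commutative dot.

Definition dendriform succ prec := tridendriform succ prec null_op.

Definition zinbiel succ := comm_tridendriform succ null_op.

Definition post_poisson lie tri succ dot :=
  let circ x y := succ x y + succ y x + dot x y in
  let br x y := tri x y - tri y x + lie x y in
  [/\ lie_algebra lie, comm_tridendriform succ dot & is_bilinear tri] /\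
  [/\ (forall x y z, tri x (lie y z) = lie (tri x y) z + lie y (tri x z)),
      (forall x y z, tri (br x y) z = tri x (tri y z) - tri y (tri x z)),
      (forall x y z, lie x (dot y z) = dot (lie x y) z + dot y (lie x z)) &
      (forall x y z, lie x (succ y z) = succ y (lie x z) - dot z (tri y x))] /\
  [/\ (forall x y z, tri x (dot y z) = dot (tri x y) z + dot y (tri x z)),
      (forall x y z, tri (circ x y) z = succ x (tri y z) + succ y (tri x z)) &
      (forall x y z, tri x (succ y z) = succ y (tri x z) + succ (br x y) z)].

Definition pre_poisson tri succ := post_poisson null_op tri succ null_op.

End Tridendriform.
End Algebras.

Arguments AssocODatum {R A V}.
Arguments PoissonODatum {R A V}.

Section Deformations.
Variable k : comNzRingType.

Definition reduces_to {A B : lmodType k} (fh : fps A -> fps B -> fps B)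
    (f : A -> B -> B) :=
  forall x y, eq_modh (fh (fps_const x) (fps_const y)) (f x y).

Definition assoc_deformation (A : lmodType k) (m : A -> A -> A)
    (mh : fps A -> fps A -> fps A) :=
  [/\ assoc_algebra m, assoc_algebra mh & reduces_to mh m].

(* [mh] deforms the commutative algebra (A, m), with quasiclassical limit     *)
(* (A, br, m).                                                                *)
Definition qcl_algebra (A : lmodType k) (m : A -> A -> A)
    (mh : fps A -> fps A -> fps A) (br : A -> A -> A) :=
  [/\ commutative m, assoc_deformation m mh &
      forall x y, divh_eq_modh (mh (fps_const x) (fps_const y) -
                                mh (fps_const y) (fps_const x)) (br x y)].

(* The canonical identification of A[[h]] (+) V[[h]] with (A (+) V)[[h]].     *)
Definition fps_pair {A V : Type} (p : fps A * fps V) : fps (A * V) :=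
  fun n => (p.1 n, p.2 n).
Definition fps_unpair {A V : Type} (u : fps (A * V)) : fps A * fps V :=
  (fun n => (u n).1, fun n => (u n).2).

Section Bimodules.
Variables A V : lmodType k.

Definition semidirect_mul_fps (mh : fps A -> fps A -> fps A)
    (dh : fps V -> fps V -> fps V) (lh rh : fps A -> fps V -> fps V)
    (u v : fps (A * V)%type) : fps (A * V)%type :=
  fps_pair (semidirect_mul mh dh lh rh (fps_unpair u) (fps_unpair v)).

Definition bimodule_algebra_deformation
    (m : A -> A -> A) (d : V -> V -> V) (l r : A -> V -> V)
    (mh : fps A -> fps A -> fps A) (dh : fps V -> fps V -> fps V)
    (lh rh : fps A -> fps V -> fps V) :=
  [/\ bimodule_algebra m d l r, bimodule_algebra mh dh lh rh &
      assoc_deformation (A := (A * V)%type)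
        (semidirect_mul m d l r) (semidirect_mul_fps mh dh lh rh)].

(* [(fps V, dh, lh, rh)] deforms the module algebra (V, d, rho), with         *)
(* quasiclassical limit (V, lie, d, rho_br, rho).                             *)
Definition qcl_module_algebra
    (m : A -> A -> A) (d : V -> V -> V) (rho : A -> V -> V)
    (mh : fps A -> fps A -> fps A) (dh : fps V -> fps V -> fps V)
    (lh rh : fps A -> fps V -> fps V)
    (lie : V -> V -> V) (rho_br : A -> V -> V) :=
  [/\ module_algebra m d rho,
      bimodule_algebra_deformation m d rho rho mh dh lh rh,
      qcl_algebra d dh lie &
      forall x u, divh_eq_modh (lh (fps_const x) (fps_const u) -
                                rh (fps_const x) (fps_const u)) (rho_br x u)].

Definition bimodule_deformation (m : A -> A -> A) (l r : A -> V -> V)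
    (mh : fps A -> fps A -> fps A) (lh rh : fps A -> fps V -> fps V) :=
  bimodule_algebra_deformation m null_op l r mh null_op lh rh.

Definition qcl_module (m : A -> A -> A) (rho : A -> V -> V)
    (mh : fps A -> fps A -> fps A) (lh rh : fps A -> fps V -> fps V)
    (rho_br : A -> V -> V) :=
  qcl_module_algebra m null_op rho mh null_op lh rh null_op rho_br.

Definition scalar_deformation (T : V -> A) (u : fps V) : fps A :=
  fun n => T (u n).

(* The map of [Dh] is the scalar deformation of that of [D], along a          *)
(* deformation of the module algebra of [D] to the bimodule algebra of [Dh].  *)
Definition scalar_deformation_datum (D : assoc_O_datum A V)
    (Dh : assoc_O_datum (fps A) (fps V)) :=
  bimodule_algebra_deformation (aod_mul D) (aod_vmul D) (aod_l D) (aod_r D)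
    (aod_mul Dh) (aod_vmul Dh) (aod_l Dh) (aod_r Dh) /\
  aod_map Dh = scalar_deformation (aod_map D).

(* [P] consists of the map of [D] and of the quasiclassical limits of the     *)
(* algebra and of the bimodule algebra of [Dh].                               *)
Definition qcl_O_datum (D : assoc_O_datum A V)
    (Dh : assoc_O_datum (fps A) (fps V)) (P : poisson_O_datum A V) :=
  [/\ scalar_deformation_datum D Dh,
      aod_r D = aod_l D,
      qcl_algebra (aod_mul D) (aod_mul Dh) (pod_br P),
      qcl_module_algebra (aod_mul D) (aod_vmul D) (aod_l D)
        (aod_mul Dh) (aod_vmul Dh) (aod_l Dh) (aod_r Dh)
        (pod_vbr P) (pod_rho_br P) &
      [/\ pod_map P = aod_map D, pod_mul P = aod_mul D,
          pod_vmul P = aod_vmul D & pod_rho_mul P = aod_l D]].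

End Bimodules.

Section TridendriformDeformation.
Variable A : lmodType k.
Implicit Types (succ prec dot lie tri : A -> A -> A)
  (succh prech doth : fps A -> fps A -> fps A).

Definition tridendriform_deformation succ prec dot succh prech doth :=
  [/\ tridendriform succ prec dot, tridendriform succh prech doth &
      [/\ reduces_to succh succ, reduces_to prech prec & reduces_to doth dot]].

Definition dendriform_deformation succ prec succh prech :=
  tridendriform_deformation succ prec null_op succh prech null_op.

Definition qcl_dendriform succ succh prech tri :=
  [/\ zinbiel succ, dendriform_deformation succ (Rmul succ) succh prech &
      forall x y, divh_eq_modh (succh (fps_const x) (fps_const y) -
                                prech (fps_const y) (fps_const x)) (tri x y)].

(* (A, lie, tri, succ, dot) is the quasiclassical limit of the tridendriform  *)
(* deformation (succh, prech, doth) of (A, succ, dot).                        *)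
Definition qcl_tridendriform succ dot succh prech doth lie tri :=
  [/\ comm_tridendriform succ dot,
      tridendriform_deformation succ (Rmul succ) dot succh prech doth,
      (forall x y, divh_eq_modh (doth (fps_const x) (fps_const y) -
                                 doth (fps_const y) (fps_const x)) (lie x y)) &
      (forall x y, divh_eq_modh (succh (fps_const x) (fps_const y) -
                                 prech (fps_const y) (fps_const x)) (tri x y))].

End TridendriformDeformation.
End Deformations.

(* Main.v *)
(** For a [k[[h]]]-bilinear map [fh] all of whose values are divisible by [h],
    the quotient [divh fh] is again bilinear over [k[[h]]], and its constant
    coefficients compute the quasiclassical limit.  Applied to the commutator of
    a deformation of a commutative algebra, this turns the Jacobi and Leibniz
    identities of the commutator, divided by powers of the non-zero-divisor [h],
    into those of the limit, which is therefore Poisson.  The quasiclassical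
    limit of a bimodule algebra deformation is the case of the semidirect
    product, and the post-Poisson identities are the components of the Poisson
    identities of the semidirect product of [A] with itself.  An [O]-datum on
    the limit is determined by the deformation because a class [u / h (mod h)]
    is unique. *)

Require Import Defs.
From mathcomp Require Import all_boot all_algebra.
From mathcomp Require Import boolp.
Set Implicit Arguments.
Unset Strict Implicit.
Unset Printing Implicit Defensive.
Import GRing.Theory.
Local Open Scope ring_scope.

(** * Bilinear maps *)

Section Bilinear.
Variables (R : nzRingType) (U V W : lmodType R) (f : U -> V -> W).
Hypothesis f_bilin : is_bilinear f.

Lemma bilinDl x y z : f (x + y) z = f x z + f y z.
Proof. by have := f_bilin.1 z 1 x y; rewrite /= !scale1r. Qed.

Lemma bilinDr x y z : f x (y + z) = f x y + f x z.
Proof. by have := f_bilin.2 x 1 y z; rewrite /= !scale1r. Qed.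

Lemma bilin0l z : f 0 z = 0.
Proof. by apply: (addrI (f 0 z)); rewrite -bilinDl !addr0. Qed.

Lemma bilin0r x : f x 0 = 0.
Proof. by apply: (addrI (f x 0)); rewrite -bilinDr !addr0. Qed.

Lemma bilinZl a x z : f (a *: x) z = a *: f x z.
Proof. by have := f_bilin.1 z a x 0; rewrite /= !addr0 bilin0l addr0. Qed.

Lemma bilinZr a x z : f x (a *: z) = a *: f x z.
Proof. by have := f_bilin.2 x a z 0; rewrite /= !addr0 bilin0r addr0. Qed.

Lemma bilinNl x z : f (- x) z = - f x z.
Proof. by rewrite -scaleN1r bilinZl scaleN1r. Qed.

Lemma bilinNr x z : f x (- z) = - f x z.
Proof. by rewrite -scaleN1r bilinZr scaleN1r. Qed.

Lemma bilinBl x y z : f (x - y) z = f x z - f y z.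
Proof. by rewrite bilinDl bilinNl. Qed.

Lemma bilinBr x y z : f x (y - z) = f x y - f x z.
Proof. by rewrite bilinDr bilinNr. Qed.

End Bilinear.

Section BilinearSums.
Variables (R : nzRingType) (U V W : lmodType R).
Implicit Types f g : U -> V -> W.

Lemma bilinear_add f g :
  is_bilinear f -> is_bilinear g -> is_bilinear (fun x y => f x y + g x y).
Proof.
move=> f_bilin g_bilin; split=> z a x y /=.
  by rewrite f_bilin.1 g_bilin.1 addrACA scalerDr.
by rewrite f_bilin.2 g_bilin.2 addrACA scalerDr.
Qed.

Lemma bilinear_sub f g :
  is_bilinear f -> is_bilinear g -> is_bilinear (fun x y => f x y - g x y).
Proof.
move=> f_bilin g_bilin; split=> z a x y /=.
  by rewrite f_bilin.1 g_bilin.1 opprD addrACA scalerBr.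
by rewrite f_bilin.2 g_bilin.2 opprD addrACA scalerBr.
Qed.

Lemma bilinear_flip f : is_bilinear f -> is_bilinear (fun y x => f x y).
Proof.
by move=> f_bilin; split=> z a x y /=; [rewrite f_bilin.2 | rewrite f_bilin.1].
Qed.

End BilinearSums.

(** * Coefficients of formal series and congruences modulo [h] *)

Section Coefficients.
Variables (k : comNzRingType) (V : lmodType k).
Implicit Types (u v : fps V) (a : fps k).

(** The quotient of [u - fps_const (u 0%N)] by [h]; it is [u / h] as soon as the constant term of
    [u] vanishes. *)
Definition fps_tail (u : fps V) : fps V := fun n => u n.+1.

Lemma fps_coef_lin a u v n :
  (a *: u + v) n = \sum_(i < n.+1) a i *: u (n - i)%N + v n.
Proof. by []. Qed.

Lemma fps_coefZ0 a u : (a *: u) 0%N = a 0%N *: u 0%N.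
Proof. by rewrite /GRing.scale /= /fps_scale big_ord1. Qed.

Lemma fps_coef_hZ u n :
  ((fps_h : fps k) *: u) n = if n is m.+1 then u m else 0.
Proof.
rewrite {1}/GRing.scale /= /fps_scale big_ord_recl /fps_h /= scale0r add0r.
case: n => [|n]; first by rewrite big_ord0.
rewrite big_ord_recl /= scale1r subSS subn0 big1 ?addr0 // => i _.
by rewrite scale0r.
Qed.

(** Multiplication by [h] shifts coefficients, so nothing is lost. Identities between quotients by
    [h] are proved by multiplying with [h] and cancelling through this lemma. *)
Lemma fps_hZ_inj : injective (fun u => (fps_h : fps k) *: u).
Proof.
move=> u v /= uv; apply/funext => n.
by have := congr1 (fun w : fps V => w n.+1) uv; rewrite /= !fps_coef_hZ.
Qed.

Lemma fps_hZ_tail u : u 0%N = 0 -> (fps_h : fps k) *: fps_tail u = u.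
Proof. by move=> u0; apply/funext => -[|n]; rewrite fps_coef_hZ. Qed.

Lemma fps_head_tail u : u = fps_const (u 0%N) + (fps_h : fps k) *: fps_tail u.
Proof.
apply/funext => n; rewrite [RHS]/GRing.add /= /fps_add fps_coef_hZ.
by case: n => [|n] /=; rewrite ?addr0 ?add0r.
Qed.

Lemma eq_modhE u (x : V) : eq_modh u x <-> u 0%N = x.
Proof.
split=> [[w /(congr1 (fun w : fps V => w 0%N))]|<-].
  by rewrite fps_coef_hZ => /eqP; rewrite subr_eq0 => /eqP.
by exists (fps_tail u); rewrite {1}[u]fps_head_tail addrAC subrr add0r.
Qed.

Lemma eq_modhD u v (x y : V) :
  eq_modh u x -> eq_modh v y -> eq_modh (u + v) (x + y).
Proof. by move=> /eq_modhE <- /eq_modhE <-; apply/eq_modhE. Qed.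

Lemma divh_eq_modhE u (x : V) : divh_eq_modh u x <-> u 0%N = 0 /\ u 1%N = x.
Proof.
split=> [[w -> /eq_modhE <-]|[u0 <-]]; first by rewrite !fps_coef_hZ.
by exists (fps_tail u); [rewrite fps_hZ_tail | apply/eq_modhE].
Qed.

Lemma divh_eq_modh_inj u (x y : V) :
  divh_eq_modh u x -> divh_eq_modh u y -> x = y.
Proof. by move=> /divh_eq_modhE[_ <-] /divh_eq_modhE[_ <-]. Qed.

End Coefficients.

(** Write each argument as its constant term plus [h] times its tail: by bilinearity every term but
    the one of the constants carries a factor [h], hence vanishes in degree 0. *)
Lemma bilinear_coef0 (k : comNzRingType) (A B C : lmodType k)
    (f : fps A -> fps B -> fps C) (u : fps A) (v : fps B) :
  is_bilinear f -> f u v 0%N = f (fps_const (u 0%N)) (fps_const (v 0%N)) 0%N.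
Proof.
move=> f_bilin; rewrite {1}[u]fps_head_tail {1}[v]fps_head_tail.
rewrite (bilinDl f_bilin) (bilinZl f_bilin) (bilinDr f_bilin).
rewrite (bilinZr f_bilin) -addrA -scalerDr.
by rewrite [LHS]/GRing.add /= /fps_add fps_coef_hZ addr0.
Qed.

(** * Division of a bilinear map by [h] *)

Section QuasiclassicalLimit.
Variables (k : comNzRingType) (A B C : lmodType k).
Variables (fh : fps A -> fps B -> fps C) (f : A -> B -> C).
Hypothesis fh_bilin : is_bilinear fh.
Hypothesis fh_qcl :
  forall x y, divh_eq_modh (fh (fps_const x) (fps_const y)) (f x y).

Definition divh (u : fps A) (v : fps B) : fps C := fps_tail (fh u v).

(** Divisibility is assumed on constant series only; it extends to all series because the constant
    term of [fh u v] depends only on those of [u] and [v]. *)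
Lemma divhK u v : (fps_h : fps k) *: divh u v = fh u v.
Proof.
apply: fps_hZ_tail; rewrite bilinear_coef0 //.
by case/divh_eq_modhE: (fh_qcl (u 0%N) (v 0%N)).
Qed.

Lemma divh_bilinear : is_bilinear divh.
Proof.
split=> z a x y; apply: (@fps_hZ_inj k) => /=.
  by rewrite scalerDr scalerA [_ * a]mulrC -scalerA !divhK fh_bilin.1.
by rewrite scalerDr scalerA [_ * a]mulrC -scalerA !divhK fh_bilin.2.
Qed.

(** The limit can be computed on arbitrary lifts of its arguments. This allows brackets to be
    nested: the inner value is lifted by a [divh], which need not be a constant series. *)
Lemma divh_coef0 u v : f (u 0%N) (v 0%N) = divh u v 0%N.
Proof.
rewrite (bilinear_coef0 _ _ divh_bilinear).
by case/divh_eq_modhE: (fh_qcl (u 0%N) (v 0%N)).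
Qed.

Lemma qcl_bilinear : is_bilinear f.
Proof.
(* A linear combination over [k] is presented as a constant coefficient, the form in which
   [divh_coef0] applies. *)
have const_lin (V : lmodType k) a (x y : V) :
    a *: x + y = (fps_const a *: fps_const x + fps_const y : fps V) 0%N.
  by rewrite [RHS]/GRing.add /= /fps_add fps_coefZ0.
split=> z a x y /=.
  rewrite (const_lin A) -[z]/(fps_const z 0%N) divh_coef0 divh_bilinear.1 /=.
  by rewrite [LHS]/GRing.add /= /fps_add fps_coefZ0 -!divh_coef0.
rewrite (const_lin B) -[z]/(fps_const z 0%N) divh_coef0 divh_bilinear.2 /=.
by rewrite [LHS]/GRing.add /= /fps_add fps_coefZ0 -!divh_coef0.
Qed.

End QuasiclassicalLimit.

(** * Commutators and the Poisson structure of the limit *)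

Section Commutator.
Variables (R : comNzRingType) (M : lmodType R) (m : M -> M -> M).
Hypothesis m_assoc : assoc_algebra m.

Definition commutator (x y : M) : M := m x y - m y x.

Lemma commutator_bilinear : is_bilinear commutator.
Proof. by apply: bilinear_sub m_assoc.1 (bilinear_flip m_assoc.1). Qed.

Lemma commutator_jacobi x y z :
  commutator x (commutator y z) + commutator y (commutator z x)
    + commutator z (commutator x y) = 0.
Proof.
(* After reassociation, the product of [x], [y], [z] in each of the six orders occurs twice, with
   opposite signs. *)
have cancel6 (a b c d e f : M) :
    a - b - (c - d) + (c - e - (f - b)) + (f - d - (a - e)) = 0.
  apply/eqP; rewrite addr_eq0 !opprB; apply/eqP.
  by rewrite (AC ((2*2)*(2*2)) (((1*6)*(3*8))*((5*4)*(7*2)))) /= !subrr !addr0.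
case: m_assoc => m_bilin mA.
rewrite /commutator !(bilinBl m_bilin) !(bilinBr m_bilin) !mA.
exact: cancel6.
Qed.

Lemma commutator_leibniz x y z :
  commutator x (m y z) = m (commutator x y) z + m y (commutator x z).
Proof.
case: m_assoc => m_bilin mA.
by rewrite /commutator (bilinBl m_bilin) (bilinBr m_bilin) !mA addrA subrK.
Qed.

End Commutator.

Lemma qcl_poisson (k : comNzRingType) (A : lmodType k) (m br : A -> A -> A)
    (mh : fps A -> fps A -> fps A) :
  qcl_algebra m mh br -> poisson_algebra br m.
Proof.
case=> mC [m_assoc mh_assoc mh_red] mh_qcl.
have mh_bilin := mh_assoc.1.
have ch_bilin := commutator_bilinear mh_assoc.
have bK := divhK ch_bilin mh_qcl.
have br0 := divh_coef0 ch_bilin mh_qcl.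
move: (divh _) bK br0 => b bK br0.
have m0 (u v : fps A) : m (u 0%N) (v 0%N) = mh u v 0%N.
  by rewrite bilinear_coef0 //; apply/esym/eq_modhE.
split=> //; first split.
- exact: qcl_bilinear ch_bilin mh_qcl.
- move=> x; rewrite -[x]/(fps_const x 0%N) br0.
  suff -> : b (fps_const x) (fps_const x) = 0 by [].
  by apply: (@fps_hZ_inj k A); rewrite /= bK /commutator subrr scaler0.
- move=> x y z.
  rewrite -[x]/(fps_const x 0%N) -[y]/(fps_const y 0%N) -[z]/(fps_const z 0%N).
  move: (fps_const x) (fps_const y) (fps_const z) => u v w; rewrite !br0.
  suff /(congr1 (fun t : fps A => t 0%N)) :
    b u (b v w) + b v (b w u) + b w (b u v) = 0 by [].
  (* Two nested brackets need two factors [h]: one turns the outer [b] into a commutator, the other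
     enters it by bilinearity and does the same to the inner [b]. In the Leibniz rule below one
     factor suffices. *)
  do 2!apply: (@fps_hZ_inj k A) => /=.
  rewrite !scalerDr !bK -!(bilinZr ch_bilin) !bK !scaler0.
  exact: commutator_jacobi.
move=> x y z.
rewrite -[x]/(fps_const x 0%N) -[y]/(fps_const y 0%N) -[z]/(fps_const z 0%N).
move: (fps_const x) (fps_const y) (fps_const z) => u v w; rewrite !(br0, m0).
suff -> : b u (mh v w) = mh (b u v) w + mh v (b u w) by [].
apply: (@fps_hZ_inj k A) => /=.
rewrite scalerDr -(bilinZl mh_bilin) -(bilinZr mh_bilin) !bK.
exact: commutator_leibniz.
Qed.

(** * Semidirect products and their limits *)

Section Semidirect.
Variables (R : comNzRingType) (A V : lmodType R).

Lemma semidirect_mul_bilinear (m : A -> A -> A) (d : V -> V -> V)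
    (l r : A -> V -> V) :
  is_bilinear m -> is_bilinear d -> is_bilinear l -> is_bilinear r ->
  is_bilinear (semidirect_mul m d l r).
Proof.
move=> m_bilin d_bilin l_bilin r_bilin; split=> z a x y.
  congr (_, _) => /=; first by rewrite m_bilin.1.
  rewrite l_bilin.1 r_bilin.2 d_bilin.1 /= !scalerDr.
  exact: (AC (2*2*2) (1*3*5*(2*4*6))).
congr (_, _) => /=; first by rewrite m_bilin.2.
rewrite l_bilin.2 r_bilin.1 d_bilin.2 /= !scalerDr.
exact: (AC (2*2*2) (1*3*5*(2*4*6))).
Qed.

End Semidirect.

Section SemidirectFps.
Variables (k : comNzRingType) (A V : lmodType k).
Variables (mh : fps A -> fps A -> fps A) (dh : fps V -> fps V -> fps V).
Variables lh rh : fps A -> fps V -> fps V.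

Lemma fps_unpair_linear : linear (@fps_unpair A V).
Proof.
move=> a u v; congr (_, _); apply/funext => n.
  by rewrite fps_coef_lin /= [RHS]fps_coef_lin (raddf_sum fst).
by rewrite fps_coef_lin /= [RHS]fps_coef_lin (raddf_sum snd).
Qed.

Lemma fps_unpair_inj : injective (@fps_unpair A V).
Proof.
move=> u v [u1 u2]; apply/funext => n; rewrite [u n]surjective_pairing.
rewrite [v n]surjective_pairing.
by have := (congr1 (@^~ n) u1, congr1 (@^~ n) u2) => -[/= -> ->].
Qed.

Lemma fps_unpair_const (p : A * V) :
  fps_unpair (fps_const p) = (fps_const p.1, fps_const p.2).
Proof. by congr (_, _); apply/funext => -[]. Qed.

Lemma fps_unpair_semidirect u v :
  fps_unpair (semidirect_mul_fps mh dh lh rh u v) =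
  semidirect_mul mh dh lh rh (fps_unpair u) (fps_unpair v).
Proof. by []. Qed.

(** Both properties are pulled back along [fps_unpair], which is linear, injective and
    multiplicative. *)
Lemma semidirect_mul_fps_assoc :
  assoc_algebra (semidirect_mul mh dh lh rh) ->
  assoc_algebra (semidirect_mul_fps mh dh lh rh).
Proof.
case=> s_bilin sA; split; last first.
  by move=> u v w; apply: fps_unpair_inj; rewrite !fps_unpair_semidirect sA.
split=> w a u v; apply: fps_unpair_inj;
  rewrite /= fps_unpair_linear !fps_unpair_semidirect fps_unpair_linear.
  exact: s_bilin.1.
exact: s_bilin.2.
Qed.

End SemidirectFps.

(** In the commutator of [(x, u)] and [(y, v)] the second component regroups as
    [(lh - rh) x v - (lh - rh) y u] plus the commutator of [u] and [v]; divided by [h], this is the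
    second component of [semidirect_br]. *)
Lemma qcl_semidirect (k : comNzRingType) (A V : lmodType k)
    (m br : A -> A -> A) (mh : fps A -> fps A -> fps A)
    (d lie : V -> V -> V) (dh : fps V -> fps V -> fps V)
    (rho rho_br : A -> V -> V) (lh rh : fps A -> fps V -> fps V) :
  qcl_algebra m mh br ->
  qcl_module_algebra m d rho mh dh lh rh lie rho_br ->
  qcl_algebra (semidirect_mul m d rho rho) (semidirect_mul_fps mh dh lh rh)
    (semidirect_br br lie rho_br).
Proof.
case=> mC _ m_qcl [_ [_ _ s_def] [dC _ d_qcl] rho_qcl]; split=> // [p q|].
  by congr (_, _) => /=; [exact: mC | rewrite [rho _ _ + _]addrC dC].
move=> [x u] [y v]; apply/divh_eq_modhE.
have coefE n :
    (semidirect_mul_fps mh dh lh rh (fps_const (x, u)) (fps_const (y, v)) -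
     semidirect_mul_fps mh dh lh rh (fps_const (y, v)) (fps_const (x, u))) n =
    ((mh (fps_const x) (fps_const y) - mh (fps_const y) (fps_const x)) n,
     (lh (fps_const x) (fps_const v) - rh (fps_const x) (fps_const v)) n -
     (lh (fps_const y) (fps_const u) - rh (fps_const y) (fps_const u)) n +
     (dh (fps_const u) (fps_const v) - dh (fps_const v) (fps_const u)) n).
  rewrite /semidirect_mul_fps !fps_unpair_const; congr (_, _).
  rewrite /= opprB !opprD; exact: (AC (3*3) ((1*5)*(2*4)*(3*6))).
rewrite !coefE /=.
have /divh_eq_modhE[-> ->] := m_qcl x y.
have /divh_eq_modhE[-> ->] := d_qcl u v.
have /divh_eq_modhE[-> ->] := rho_qcl x v.
by have /divh_eq_modhE[-> ->] := rho_qcl y u; rewrite subrr addr0.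
Qed.

Lemma qcl_module_poisson (k : comNzRingType) (A V : lmodType k)
    (m br : A -> A -> A) (mh : fps A -> fps A -> fps A)
    (d lie : V -> V -> V) (dh : fps V -> fps V -> fps V)
    (rho rho_br : A -> V -> V) (lh rh : fps A -> fps V -> fps V) :
  qcl_algebra m mh br ->
  qcl_module_algebra m d rho mh dh lh rh lie rho_br ->
  module_poisson_algebra br m lie d rho_br rho.
Proof.
move=> m_qcl V_qcl; split.
- exact: qcl_poisson m_qcl.
- case: V_qcl => _ [_ [_ _ lh_bilin rh_bilin _] _] _ rho_qcl.
  exact: qcl_bilinear (bilinear_sub lh_bilin rh_bilin) rho_qcl.
- by case: V_qcl => -[_ _ []].
- exact: qcl_poisson (qcl_semidirect m_qcl V_qcl).
Qed.

(** * Tridendriform and post-Poisson algebras through semidirect products *)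

(** The sum of the seven axioms is associativity of the total product; taken separately, they match
    the seven terms of the module component of semidirect associativity. *)
Lemma tridendriform_bimodule_algebra (R : comNzRingType) (A : lmodType R)
    (succ prec dot : A -> A -> A) :
  tridendriform succ prec dot ->
  bimodule_algebra (tridendriform_mul succ prec dot) dot
    (Lmul succ) (Rmul prec).
Proof.
case=> [[succ_bilin prec_bilin dot_bilin] [[pp sp cs] [sd pd dp dd]]].
have circ_bilin : is_bilinear (tridendriform_mul succ prec dot).
  by apply: bilinear_add => //; apply: bilinear_add.
have succE x y z :
    succ x (succ y z) =
    succ (succ x y) z + succ (prec x y) z + succ (dot x y) z.
  by rewrite -cs /tridendriform_mul !(bilinDl succ_bilin).
have precE x y z :
    prec (prec x y) z =
    prec x (succ y z) + prec x (prec y z) + prec x (dot y z).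
  by rewrite pp /tridendriform_mul !(bilinDr prec_bilin).
have circA : associative (tridendriform_mul succ prec dot).
  move=> x y z; rewrite /tridendriform_mul.
  rewrite !(bilinDl succ_bilin, bilinDr succ_bilin, bilinDl prec_bilin).
  rewrite !(bilinDr prec_bilin, bilinDl dot_bilin, bilinDr dot_bilin).
  rewrite succE precE sp sd pd dp dd.
  (* Each side has nine products, one of which [succE] or [precE] has split into three, leaving the
     same eleven terms in different orders. *)
  exact: (AC ((3*1*1)*3*3) ((1*2*3)*(4*(6*7*8)*10)*(5*9*11))).
have l_bilin : is_bilinear (Lmul succ) by [].
have r_bilin : is_bilinear (Rmul prec) by apply: bilinear_flip.
have dotA : associative dot by move=> x y z.
split=> //; split; first exact: semidirect_mul_bilinear.
move=> [x u] [y v] [z w]; congr (_, _); rewrite /= ?circA //.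
rewrite /Lmul /Rmul cs -pp.
rewrite !(bilinDl prec_bilin, bilinDr succ_bilin).
rewrite !(bilinDl dot_bilin, bilinDr dot_bilin) sp sd pd dp dd.
exact: (AC (3*1*3) (1*(2*4*6)*(3*5*7))).
Qed.

Lemma lie_algebra_anticomm (R : comNzRingType) (A : lmodType R)
    (lie : A -> A -> A) x y :
  lie_algebra lie -> lie x y = - lie y x.
Proof.
case=> lie_bilin lie_alt _; apply/eqP; rewrite -addr_eq0; apply/eqP.
have := lie_alt (x + y); rewrite (bilinDl lie_bilin) !(bilinDr lie_bilin).
by rewrite !lie_alt addr0 add0r.
Qed.

(** Each identity is the second component of Jacobi or Leibniz in the sum of two copies of [A],
    evaluated at arguments lying in a single summand; [simp0] clears the zero entries. *)
Lemma post_poisson_of_module (R : comNzRingType) (A : lmodType R)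
    (lie tri succ dot : A -> A -> A) :
  let circ x y := succ x y + succ y x + dot x y in
  let br x y := tri x y - tri y x + lie x y in
  comm_tridendriform succ dot -> lie_algebra lie ->
  module_poisson_algebra br circ lie dot (Lmul tri) (Lmul succ) ->
  post_poisson lie tri succ dot.
Proof.
move=> circ br S_trid lie_lie [_ tri_bilin _ [[_ _ jac] _ _ leib]].
have lie_bilin : is_bilinear lie by case: lie_lie.
have [[[succ_bilin _ dot_bilin] _] dotC] := S_trid.
have {}tri_bilin : is_bilinear tri by [].
have snd_eq (p q : A * A) : p = q -> p.2 = q.2 by move->.
have jacE p q r := snd_eq _ _ (jac p q r).
have leibE p q r := snd_eq _ _ (leib p q r).
rewrite /= /Lmul in jacE leibE.
pose simp0 := (subr0, sub0r, addr0, add0r, oppr0,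
  bilin0l tri_bilin, bilin0r tri_bilin, bilin0l lie_bilin,
  bilin0r lie_bilin, bilin0l succ_bilin, bilin0r succ_bilin,
  bilin0l dot_bilin, bilin0r dot_bilin).
split=> //; split; [split | split] => x y z.
- have := jacE (x, 0) (0, y) (0, z); rewrite /= /br !simp0 (bilinNr lie_bilin).
  rewrite (lie_algebra_anticomm z _ lie_lie) -addrA -opprD.
  by move/eqP; rewrite subr_eq0 addrC => /eqP.
- have := jacE (x, 0) (y, 0) (0, z); rewrite /= /br !simp0 (bilinNr tri_bilin).
  by move/eqP; rewrite subr_eq0 => /eqP.
- by have := leibE (0, x) (0, y) (0, z); rewrite /= /circ /br !simp0.
- have := leibE (0, x) (y, 0) (0, z).
  by rewrite /= /circ /br !simp0 (bilinNl dot_bilin) addrC [dot _ z]dotC.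
- by have := leibE (x, 0) (0, y) (0, z); rewrite /= /circ /br !simp0.
(* With the module element in the first slot, the bracket with [(x, 0)] is minus the action of [x],
   so the identity appears negated on both sides. *)
- have := leibE (0, z) (x, 0) (y, 0); rewrite /= /circ /br !simp0.
  rewrite !(bilinNr succ_bilin) -opprD => /oppr_inj ->.
  exact: addrC.
- have := leibE (x, 0) (y, 0) (0, z); rewrite /= /circ /br !simp0 => ->.
  exact: addrC.
Qed.

(** * Deformations of commutative tridendriform algebras *)

Section TridendriformDeformation.
Variables (k : comNzRingType) (A : lmodType k).
Variables succ dot lie tri : A -> A -> A.
Variables succh prech doth : fps A -> fps A -> fps A.
Hypothesis qcl : qcl_tridendriform succ dot succh prech doth lie tri.

Let circ x y := succ x y + succ y x + dot x y.
Let br x y := tri x y - tri y x + lie x y.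
Let circh x y := succh x y + prech x y + doth x y.

(** The commutator of [circh] regroups into [succh x y - prech y x], minus the same with [x] and [y]
    exchanged, plus the commutator of [doth]; the limits are [tri x y], [tri y x] and [lie x y]. *)
Lemma tridendriform_qcl_algebra : qcl_algebra circ circh br.
Proof.
case: qcl => -[succ_trid dotC] [_ h_trid [? ? ?]] dot_qcl tri_qcl.
split=> [x y||x y].
- by rewrite /circ dotC [succ x y + _]addrC.
- split.
  + by case: (tridendriform_bimodule_algebra succ_trid).
  + by case: (tridendriform_bimodule_algebra h_trid).
  by move=> x y; do 2?apply: eq_modhD.
apply/divh_eq_modhE.
have coefE n :
    (circh (fps_const x) (fps_const y) - circh (fps_const y) (fps_const x)) n =
    (succh (fps_const x) (fps_const y) - prech (fps_const y) (fps_const x)) n -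
    (succh (fps_const y) (fps_const x) - prech (fps_const x) (fps_const y)) n +
    (doth (fps_const x) (fps_const y) - doth (fps_const y) (fps_const x)) n.
  rewrite /circh [LHS]/GRing.add /= /fps_add.
  rewrite opprB !opprD; exact: (AC (3*3) ((1*5)*(2*4)*(3*6))).
rewrite !coefE.
have /divh_eq_modhE[-> ->] := tri_qcl x y.
have /divh_eq_modhE[-> ->] := tri_qcl y x.
by have /divh_eq_modhE[-> ->] := dot_qcl x y; rewrite subrr addr0.
Qed.

(** As [prech] reduces to [Rmul succ], its right multiplications reduce to [Lmul succ], so both
    actions have the same reduction. *)
Lemma tridendriform_bimodule_algebra_deformation :
  bimodule_algebra_deformation circ dot (Lmul succ) (Lmul succ)
    circh doth (Lmul succh) (Rmul prech).
Proof.
case: qcl => -[/tridendriform_bimodule_algebra bim _].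
case=> _ /tridendriform_bimodule_algebra bimh.
case=> succ_red prec_red dot_red _ _.
split=> //; split.
- by case: bim.
- by apply: semidirect_mul_fps_assoc; case: bimh.
move=> [x u] [y v]; apply/eq_modhE.
rewrite /semidirect_mul_fps !fps_unpair_const.
congr (_, _); apply/eq_modhE; do 2?apply: eq_modhD;
  by [exact: succ_red | exact: prec_red | exact: dot_red].
Qed.

(** The difference of the two actions of [x] on [u] is [succh x u - prech u x], the expression whose
    limit is [tri x u]. *)
Lemma tridendriform_qcl_module_algebra :
  qcl_module_algebra circ dot (Lmul succ)
    circh doth (Lmul succh) (Rmul prech) lie (Lmul tri).
Proof.
have [circC _ _] := tridendriform_qcl_algebra.
have bim_def := tridendriform_bimodule_algebra_deformation.
have [[_ dotC] [_ _ [_ _ dot_red]] dot_qcl tri_qcl] := qcl.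
have [[_ dot_assoc _ _ _] [_ doth_assoc _ _ _] _] := bim_def.
split=> //; split=> //.
by case: bim_def.
Qed.

End TridendriformDeformation.

(** * Uniqueness of the limit datum and assembly of the theorem *)

Lemma qcl_O_datum_unique (k : comNzRingType) (A V : lmodType k)
    (D : assoc_O_datum A V) (Dh : assoc_O_datum (fps A) (fps V))
    (P P' : poisson_O_datum A V) :
  qcl_O_datum D Dh P -> qcl_O_datum D Dh P' -> P = P'.
Proof.
case: P P' => [T br m lie d rho_br rho] [T' br' m' lie' d' rho_br' rho'].
case=> /= _ _ [_ _ br_qcl] [_ _ [_ _ lie_qcl] rho_qcl] [-> -> -> ->].
case=> /= _ _ [_ _ br_qcl'] [_ _ [_ _ lie_qcl'] rho_qcl'] [-> -> -> ->].
congr PoissonODatum; apply/funext => x; apply/funext => y.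
- exact: divh_eq_modh_inj (br_qcl x y) (br_qcl' x y).
- exact: divh_eq_modh_inj (lie_qcl x y) (lie_qcl' x y).
- exact: divh_eq_modh_inj (rho_qcl x y) (rho_qcl' x y).
Qed.

Theorem theorem3p16 (k : fieldType) (k_char0 : [pchar k] =i pred0)
    (A : lmodType k) :
  (forall (succ dot lie tri : A -> A -> A)
          (succh prech doth : fps A -> fps A -> fps A),
    comm_tridendriform succ dot ->
    tridendriform_deformation succ (Rmul succ) dot succh prech doth ->
    qcl_tridendriform succ dot succh prech doth lie tri ->
    let circ := fun x y : A => succ x y + succ y x + dot x y in
    let br := fun x y : A => tri x y - tri y x + lie x y in
    let circh := fun x y : fps A => succh x y + prech x y + doth x y in
    let D := AssocODatum id circ dot (Lmul succ) (Lmul succ) in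
    let Dh := AssocODatum id circh doth (Lmul succh) (Rmul prech) in
    let P := PoissonODatum id br circ lie dot (Lmul tri) (Lmul succ) in
    (* (1) *)
    [/\ bimodule_algebra circh doth (Lmul succh) (Rmul prech),
        module_algebra circ dot (Lmul succ) &
        bimodule_algebra_deformation circ dot (Lmul succ) (Lmul succ)
          circh doth (Lmul succh) (Rmul prech)] /\
    [/\ qcl_algebra circ circh br,
        qcl_module_algebra circ dot (Lmul succ)
          circh doth (Lmul succh) (Rmul prech) lie (Lmul tri) &
        module_poisson_algebra br circ lie dot (Lmul tri) (Lmul succ)] /\
    (* (2) *)
    [/\ assoc_O_operator 1 D,
        assoc_O_operator 1 Dh,
        scalar_deformation_datum D Dh &
        (id : fps A -> fps A) = scalar_deformation (id : A -> A)] /\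
    (* (3) *)
    [/\ post_poisson lie tri succ dot,
        poisson_O_operator 1 P &
        forall P' : poisson_O_datum A A, qcl_O_datum D Dh P' <-> P' = P]) /\
  (forall (succ tri : A -> A -> A) (succh prech : fps A -> fps A -> fps A),
    zinbiel succ ->
    dendriform_deformation succ (Rmul succ) succh prech ->
    qcl_dendriform succ succh prech tri ->
    let circ := fun x y : A => succ x y + succ y x in
    let br := fun x y : A => tri x y - tri y x in
    let circh := fun x y : fps A => succh x y + prech x y in
    let D := AssocODatum id circ null_op (Lmul succ) (Lmul succ) in
    let Dh := AssocODatum id circh null_op (Lmul succh) (Rmul prech) in
    let P := PoissonODatum id br circ null_op null_op (Lmul tri) (Lmul succ) in
    (* (1) *)
    [/\ bimodule circh (Lmul succh) (Rmul prech),
        assoc_module circ (Lmul succ) &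
        bimodule_deformation circ (Lmul succ) (Lmul succ)
          circh (Lmul succh) (Rmul prech)] /\
    [/\ qcl_algebra circ circh br,
        qcl_module circ (Lmul succ)
          circh (Lmul succh) (Rmul prech) (Lmul tri) &
        poisson_module br circ (Lmul tri) (Lmul succ)] /\
    (* (2) *)
    [/\ assoc_O_operator 1 D,
        assoc_O_operator 1 Dh,
        scalar_deformation_datum D Dh &
        (id : fps A -> fps A) = scalar_deformation (id : A -> A)] /\
    (* (3) *)
    [/\ pre_poisson tri succ,
        poisson_O_operator 1 P &
        forall P' : poisson_O_datum A A, qcl_O_datum D Dh P' <-> P' = P]).
Proof.
(* The first half is made available to the second, since the Zinbiel case is its instance at
   [null_op]. *)
have conj_dep (P Q : Prop) : P -> (P -> Q) -> P /\ Q by split; auto.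
apply: conj_dep => [|tridendriform_case].
  move=> succ dot lie tri succh prech doth S_trid S_def S_qcl.
  move=> circ br circh D Dh P.
  have circ_qcl := tridendriform_qcl_algebra S_qcl.
  have mod_qcl := tridendriform_qcl_module_algebra S_qcl.
  have mod_poisson := qcl_module_poisson circ_qcl mod_qcl.
  have [mod_alg def [_ _ lie_qcl] _] := mod_qcl.
  have [bim bimh _] := def.
  (* The maps agree by conversion: applying [id] to every coefficient returns the series. *)
  have P_qcl : qcl_O_datum D Dh P by split.
  split; first by [].
  split; first by [].
  split; split => //.
  (* For the identity map and weight 1, the operator equation is the definition of the total
     product. *)
  - by split=> // x y; rewrite scale1r.
  - by split=> // x y; rewrite scale1r.
  (* The Lie structure [lie] comes from the deformation [doth] of [dot] alone. *)
  - by apply: post_poisson_of_module => //; case: mod_qcl => _ _ /qcl_poisson[].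
  - by split=> // x y; rewrite scale1r.
  - by move=> P'; split=> [/(qcl_O_datum_unique P_qcl) | ->].
move=> succ tri succh prech S_zinb S_def S_qcl circ br circh D Dh P.
(* The instance carries a summand [null_op x y] in each total operation; these equalities absorb
   it. *)
have circE : circ = (fun x y => succ x y + succ y x + null_op x y).
  by apply/funext => x; apply/funext => y; rewrite addr0.
have brE : br = (fun x y => tri x y - tri y x + null_op x y).
  by apply/funext => x; apply/funext => y; rewrite addr0.
have circhE : circh = (fun x y => succh x y + prech x y + null_op x y).
  by apply/funext => x; apply/funext => y; rewrite addr0.
have T_qcl : qcl_tridendriform succ null_op succh prech null_op null_op tri.
  case: S_qcl => _ _ tri_qcl; split=> // x y.
  by apply/divh_eq_modhE; rewrite subrr.
have := tridendriform_case _ _ _ _ _ _ _ S_zinb S_def T_qcl.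
by cbv zeta; rewrite -circE -brE -circhE.
Qed.
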